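(* Let $\mathfrak{g}$ be a $3$-dimensional Lie algebra with trivial center over a field $\mathbb{F}$ of characteristic $0$, with a non-degenerate symmetric bilinear form $(\ ,\ )$. Then the following assertions are equivalent. a) $\mathfrak{g}$ is a pseudo-Riemannian Lie algebra. b) There exists a basis $x,y,z$ of $\mathfrak{g}$ such that $[x,y]=z$, $[x,z]=cy$ with $c\neq 0$ (and $[y,z]=0$). In this case, the product can be given by $xy=[x,y]$, $xz=[x,z]$, otherwise $0$. And the bilinear form is given by $(x,x)=a$, $(y,y)=b$, $(z,z)=-bc$ for any $a\neq 0$, $b\neq 0$, otherwise $0$. If $\mathbb{F}=\mathbb{R}$ and $c<0$, then choosing $a>0$, $b>0$, one sees that $\mathfrak{g}$ is a Riemann-Lie algebra. Choosing an orthonormal basis, one gets the following: if $\mathfrak{g}$ is a $3$-dimensional non-abelian Riemann-Lie algebra, then $\dim[\mathfrak{g},\mathfrak{g}]=2$ and there exists an orthonormal basis $s,x,y$ of $\mathfrak{g}$ such that $s\in Z_r(\mathfrak{g})$, $x,y\in[\mathfrak{g},\mathfrak{g}]$, $[s,x]=sx=\alpha y$ and $[s,y]=sy=-\alpha x$ for some $\alpha\in\mathbb{R}$.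
   Context: A pseudo-Riemannian Lie algebra over a field $\mathbb{F}$ with $\operatorname{char}\mathbb{F}\neq 2$ is a Lie algebra $\mathfrak{g}$ with a non-degenerate symmetric bilinear form $(\ ,\ )$ such that the bilinear product $(u,v)\mapsto uv$ on $\mathfrak{g}$ defined by $2(uv,w)=([u,v],w)+([w,u],v)+([w,v],u)$ satisfies $[uv,w]+[u,wv]=0$ for all $u,v,w\in\mathfrak{g}$. The defining formula for the product is equivalent to the two conditions $uv-vu=[u,v]$ and $(uv,w)+(v,uw)=0$ for all $u,v,w\in\mathfrak{g}$. It is called a Riemann-Lie algebra if $(\ ,\ )$ is positive definite. Here $Z_r(\mathfrak{g})=\{u\in\mathfrak{g}: vu=0\text{ for all }v\in\mathfrak{g}\}$. ''Otherwise $0$'' refers to the remaining pairs of basis vectors.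
   Formalization: In a) the form is not the given one: a) reads ''some non-degenerate symmetric form makes g pseudo-Riemannian'', since b) implies a) fails for a fixed form; for a fixed form, a) is equivalent to a basis as in b) with product and form as displayed. *)

(* Defs.v *)
From HB Require Import structures.
From mathcomp Require Import all_boot all_order all_algebra.
From mathcomp Require Import sesquilinear reals ring.
Set Implicit Arguments.
Unset Strict Implicit.
Unset Printing Implicit Defensive.
Import Order.TTheory GRing.Theory Num.Theory.
Local Open Scope ring_scope.

HB.mixin Record Vector_isLieAlgebra (F : fieldType) g of Vector F g := {
  lie : {bilinear g -> g -> g};
  liexx : forall u : g, lie u u = 0;
  lie_jacobi : forall u v w : g,
    lie u (lie v w) + lie v (lie w u) + lie w (lie u v) = 0
}.

#[short(type="lieAlgType")]
HB.structure Definition LieAlgebra (F : fieldType) :=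
  { g of Vector F g & Vector_isLieAlgebra F g }.

Section LieAlgebraDefs.
Variables (F : fieldType) (g : lieAlgType F).

Definition trivial_center := forall u : g, (forall v : g, lie u v = 0) -> u = 0.

Definition abelian_lie := forall u v : g, lie u v = 0.

Definition derived : {vspace g} :=
  <<[seq lie u v | u <- vbasis {: g}, v <- vbasis {: g}]>>%VS.

Lemma derivedP (U : {vspace g}) :
  (forall u v : g, lie u v \in U) <-> (derived <= U)%VS.
Proof.
split=> [lieU | /subvP dU u v].
  by apply/span_subvP => _ /allpairsP[[u v] [_ _ ->]]; apply: lieU.
apply: dU; rewrite (coord_vbasis (memvf u)) (coord_vbasis (memvf v)).
rewrite linear_sumlz; apply: rpred_sum => i _.
rewrite linear_sumr; apply: rpred_sum => j _.
rewrite linearZl_LR linearZr_LR; do 2!apply: rpredZ.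
by apply/memv_span/allpairs_f; apply/mem_nth; rewrite size_tuple.
Qed.

End LieAlgebraDefs.
Arguments trivial_center {F} g.
Arguments abelian_lie {F} g.
Arguments derived {F} g.

Section PseudoRiemannian.
Variables (F : fieldType) (g : lieAlgType F) (B : {symmetric g}).

(* The map u |-> (u, .) from g to its dual; it is invertible when B is
   non-degenerate. *)
Definition flat : 'Hom(g, 'Hom(g, F^o)) :=
  linfun (fun u : g => linfun (fun w : g => B u w : F^o)).

(* lprod u v is the vector written uv in the literature: it represents, via B,
   the linear form w |-> (([u,v],w) + ([w,u],v) + ([w,v],u)) / 2. It is
   meaningful only when B is non-degenerate and 2 is invertible; see lprodE. *)
Definition lprod (u v : g) : g :=
  (flat^-1)%VF (linfun (fun w : g =>
    2%:R^-1 * (B (lie u v) w + B (lie w u) v + B (lie w v) u) : F^o)).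

Lemma flatE u w : flat u w = B u w.
Proof.
have lin1 (t : g) : linear (fun w0 : g => B t w0 : F^o).
  by move=> k p q; rewrite linearPr.
pose l1 t := HB.pack_for {linear g -> F^o} (fun w0 : g => B t w0 : F^o)
  (GRing.isLinear.Build _ _ _ _ _ (lin1 t)).
have E1 t w0 : linfun (fun w1 : g => B t w1 : F^o) w0 = B t w0.
  exact: (lfunE (l1 t)).
have lin2 : linear (fun t : g => linfun (fun w0 : g => B t w0 : F^o)).
  move=> k p q; apply/lfunP => t.
  by rewrite add_lfunE scale_lfunE !E1 linearPl.
pose l2 := HB.pack_for {linear g -> 'Hom(g, F^o)}
  (fun t : g => linfun (fun w0 : g => B t w0 : F^o))
  (GRing.isLinear.Build _ _ _ _ _ lin2).
by rewrite -(E1 u w) /flat (lfunE l2).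
Qed.

Lemma nondegenerateP :
  reflect (forall u, (forall v, B u v = 0) -> u = 0) (nondegenerate B).
Proof.
apply: (iffP eqP) => [rad0 u u0 | nd].
  by apply/eqP; rewrite -memv0 -rad0; apply/mem_orthovP => v _; apply: u0.
apply/eqP; rewrite -subv0; apply/subvP => u /mem_orthovP u0.
by rewrite memv0; apply/eqP/nd => v; apply: u0; apply: memvf.
Qed.

Lemma lprodE : 2%N \notin [pchar F] -> nondegenerate B ->
  forall u v w,
    2%:R * B (lprod u v) w = B (lie u v) w + B (lie w u) v + B (lie w v) u.
Proof.
move=> char2 /nondegenerateP nd u v w.
have n2 : 2%:R != 0 :> F by move: char2; rewrite inE.
have ker0 : (lker flat == 0)%VS.
  rewrite -subv0; apply/subvP => t; rewrite memv_ker memv0 => /eqP t0.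
  by apply/eqP/nd => s; rewrite -flatE t0 zero_lfunE.
have full : limg flat = fullv.
  apply/eqP; rewrite eqEdim subvf /= limg_dim_eq ?(eqP ker0) ?capv0 //.
  by rewrite !dimvf /dim /= muln1.
rewrite -flatE /lprod limg_lfunVK ?full ?memvf //.
pose h w0 := 2%:R^-1 * (B (lie u v) w0 + B (lie w0 u) v + B (lie w0 v) u) : F^o.
have linh : linear h.
  move=> k p q; rewrite /h [in LHS]linearPr.
  rewrite (linearPl lie u) /= (linearPl lie v) /= !linearPl /=.
  by rewrite /GRing.scale /=; ring.
pose lh := HB.pack_for {linear g -> F^o} h
  (GRing.isLinear.Build _ _ _ _ _ linh).
by rewrite (lfunE lh) /= /h mulVKf.
Qed.

Definition pseudo_riemannian_lie :=
  [/\ 2%N \notin [pchar F], nondegenerate B &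
      forall u v w : g, lie (lprod u v) w + lie u (lprod w v) = 0].

Definition in_Zr (u : g) := forall v : g, lprod v u = 0.

End PseudoRiemannian.

Definition riemann_lie (R : realType) (g : lieAlgType R) (B : {symmetric g}) :=
  pseudo_riemannian_lie B /\ (forall u : g, u != 0 -> 0 < B u u).

Section NormalForm.
Variables (F : fieldType) (g : lieAlgType F).
Implicit Types (B : {symmetric g}) (a b c : F) (x y z : g).

Definition normal_basis c x y z :=
  [/\ basis_of {: g} [:: x; y; z],
      lie x y = z, lie x z = c *: y & lie y z = 0].

Definition normal_product B x y z :=
  [/\ [/\ lprod B x x = 0, lprod B x y = lie x y & lprod B x z = lie x z],
      [/\ lprod B y x = 0, lprod B y y = 0 & lprod B y z = 0] &
      [/\ lprod B z x = 0, lprod B z y = 0 & lprod B z z = 0]].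

Definition normal_form B a b c x y z :=
  [/\ B x x = a, B y y = b & B z z = - (b * c)] /\
  [/\ B x y = 0, B x z = 0 & B y z = 0].

End NormalForm.

(* Main.v *)
(* Write T_v u = uv. Compatibility reads [T_v u, w] + [u, T_v w] = 0: the
   bracket kills the action of T_v on bivectors. In dimension 3, if the bracket
   were injective on bivectors, this would force T_v = 0, so its kernel contains
   a bivector, i.e. there is an abelian plane p. When the center is trivial, T_v
   acts on p as a scalar t(v), and skew-symmetry of the product gives
   t(v) (u, v) = (uv, v) = 0 for u in p, whence t = 0, p g = 0 and g g lies in
   p. A vector s orthogonal to p then satisfies g s = 0; triviality of the center
   makes p non-degenerate, and an anisotropic y in p yields the basis s, y, sy.
   In the positive definite case a non-abelian algebra has trivial center: a
   central r gives a skew operator L_r with L_r^2 = 0, so L_r = 0, and the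
   product then lives on the plane orthogonal to r, where the compatibility
   condition kills the bracket. *)
From HB Require Import structures.
Require Import Defs.
From mathcomp Require Import all_boot all_order all_algebra.
From mathcomp Require Import sesquilinear reals ring.
Set Implicit Arguments.
Unset Strict Implicit.
Unset Printing Implicit Defensive.
Import Order.TTheory GRing.Theory Num.Theory.
Import VectorInternalTheory.
Local Open Scope ring_scope.

(* Coordinates turn identities in a vector space into ring identities. *)
Ltac vector_ring :=
  apply: v2r_inj; apply/rowP => ?;
  rewrite ?(linearD, linearB, linearN, linearZ, linear0, mxE) /=; ring.

(** * Triples of vectors in dimension 3 *)

Section Triples.
Variables (F : fieldType) (V : vectType F).
Implicit Types (x y z u : V) (a b c : F).

Lemma free3P x y z :
  free [:: x; y; z] <->
  forall a b c, a *: x + b *: y + c *: z = 0 -> [/\ a = 0, b = 0 & c = 0].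
Proof.
split=> [/(freeP (X := [tuple x; y; z])) fr a b c E | fr].
  have {}fr := fr (fun i => [:: a; b; c]`_i).
  rewrite !big_ord_recl big_ord0 /= addr0 addrA in fr.
  by have H := fr E; split; [exact: (H 0) | exact: (H 1) |];
    exact: (H (lift ord0 (lift ord0 ord0))).
apply/(freeP (X := [tuple x; y; z])) => k.
rewrite !big_ord_recl big_ord0 /= addr0 addrA => /fr[k0 k1 k2] i.
case: i => -[|[|[]]] // Hi; [rewrite -k0 | rewrite -k1 | rewrite -k2];
  by congr k; apply: val_inj.
Qed.

Lemma free2P x y :
  free [:: x; y] <-> forall a b, a *: x + b *: y = 0 -> a = 0 /\ b = 0.
Proof.
split=> [/(freeP (X := [tuple x; y])) fr a b E | fr].
  have {}fr := fr (fun i => [:: a; b]`_i).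
  rewrite !big_ord_recl big_ord0 /= addr0 in fr.
  by have H := fr E; split; [exact: (H 0) | exact: (H 1)].
apply/(freeP (X := [tuple x; y])) => k.
rewrite !big_ord_recl big_ord0 /= addr0 => /fr[k0 k1] i.
case: i => -[|[]] // Hi; [rewrite -k0 | rewrite -k1];
  by congr k; apply: val_inj.
Qed.

Lemma nfree3P x y z :
  ~~ free [:: x; y; z] -> exists a b c,
    a *: x + b *: y + c *: z = 0 /\ [|| a != 0, b != 0 | c != 0].
Proof.
rewrite !free_cons nil_free andbT !negb_and !negbK => /or3P[].
- rewrite !span_cons span_nil addv0.
  case/memv_addP => _ /vlineP[b ->] [_ /vlineP[c ->] ->].
  by exists (-1), b, c; rewrite oppr_eq0 oner_eq0; split=> //; vector_ring.
- rewrite span_seq1 => /vlineP[c ->].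
  by exists 0, (-1), c; rewrite oppr_eq0 oner_eq0 orbT; split=> //; vector_ring.
rewrite span_nil memv0 => /eqP->.
by exists 0, 0, 1; rewrite oner_eq0 !orbT; split=> //; vector_ring.
Qed.

Lemma basis3_span x y z u : basis_of {: V} [:: x; y; z] ->
  exists a b c, u = a *: x + b *: y + c *: z.
Proof.
move=> bas; have := coord_basis (X := [tuple x; y; z]) bas (memvf u).
rewrite !big_ord_recl big_ord0 /= addr0 addrA => ->.
by do 3!eexists.
Qed.

Lemma basis3_free x y z : \dim {: V} = 3%N -> free [:: x; y; z] ->
  basis_of {: V} [:: x; y; z].
Proof. by move=> d3 fr; rewrite basisEfree fr subvf d3. Qed.

Lemma basis3_complete x y : \dim {: V} = 3%N -> free [:: x; y] ->
  exists u, basis_of {: V} [:: u; x; y].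
Proof.
move=> d3 fr; have /subvPn[u _ nu] : ~~ ({: V} <= <<[:: x; y]>>)%VS.
  by apply: contraTN (dim_span [:: x; y]) => /dimvS; rewrite d3 -ltnNge.
by exists u; apply: basis3_free => //; rewrite free_cons nu.
Qed.

Lemma dim3_basis : \dim {: V} = 3%N ->
  exists x y z, basis_of {: V} [:: x; y; z].
Proof.
move=> d3; have := vbasisP {: V}; case: (vbasis _) => -[|x[|y[|z[|? ?]]]] /=;
  rewrite d3 // => _ bas.
by exists x, y, z.
Qed.

End Triples.

(** * Rules for the bracket and the form; characterization of the product *)

Section Algebra.
Variables (F : fieldType) (g : lieAlgType F).
Implicit Types (u v w : g) (k : F).

Lemma lieDl u v w : lie (u + v) w = lie u w + lie v w.
Proof. exact: linearDl. Qed.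
Lemma lieDr u v w : lie u (v + w) = lie u v + lie u w.
Proof. exact: linearDr. Qed.
Lemma lieZl k u v : lie (k *: u) v = k *: lie u v.
Proof. exact: linearZl_LR. Qed.
Lemma lieZr k u v : lie u (k *: v) = k *: lie u v.
Proof. exact: linearZr_LR. Qed.
Lemma lieC u v : lie u v = - lie v u.
Proof.
apply/eqP; rewrite -addr_eq0; have := liexx (u + v).
by rewrite lieDl !lieDr !liexx add0r addr0 => /eqP.
Qed.

Definition lieE := (lieDl, lieDr, lieZl, lieZr, (@liexx F g),
  linear0l (@lie F g), linear0r (@lie F g),
  linearNl (@lie F g), linearNr (@lie F g)).

Variable B : {symmetric g}.
Lemma symformDl u v w : B (u + v) w = B u w + B v w.
Proof. exact: linearDl. Qed.
Lemma symformDr u v w : B u (v + w) = B u v + B u w.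
Proof. exact: linearDr. Qed.
Lemma symformZl k u v : B (k *: u) v = k * B u v.
Proof. exact: linearZl_LR. Qed.
Lemma symformZr k u v : B u (k *: v) = k * B u v.
Proof. exact: linearZr_LR. Qed.
Lemma symformC u v : B u v = B v u.
Proof. by rewrite hermC /= expr0 mul1r. Qed.
Lemma symformNl u v : B (- u) v = - B u v.
Proof. exact: linearNl. Qed.
Lemma symformNr u v : B u (- v) = - B u v.
Proof. exact: linearNr. Qed.
Lemma symform0l u : B 0 u = 0.
Proof. exact: linear0l. Qed.
Lemma symform0r u : B u 0 = 0.
Proof. exact: linear0r. Qed.
Definition symformE :=
  (symformDl, symformDr, symformZl, symformZr, symformNl, symformNr,
   symform0l, symform0r).

Hypotheses (char2 : 2%N \notin [pchar F]) (nd : nondegenerate B).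

Let n2 : 2%:R != 0 :> F. Proof. by move: char2; rewrite inE. Qed.

Lemma symform_inj u v : (forall w, B u w = B v w) -> u = v.
Proof.
move=> E; apply/eqP; rewrite -subr_eq0; apply/eqP.
by apply: (elimT (nondegenerateP B) nd) => w; rewrite !symformE E subrr.
Qed.

Lemma symform_inj3 x y z u v : basis_of {: g} [:: x; y; z] ->
  B u x = B v x -> B u y = B v y -> B u z = B v z -> u = v.
Proof.
move=> bas Ex Ey Ez; apply: symform_inj => w.
by have [a [b [c ->]]] := basis3_span w bas; rewrite !symformE Ex Ey Ez.
Qed.

(** Swapping [v] and [w] changes the sign of the right side of [lprodE]. Together with
    [lprod_torsion_free] this is equivalent to the defining formula; the search for a normal form
    uses the product only through these two facts, bilinearity and compatibility. *)
Lemma lprod_skew u v w : B (lprod B u v) w = - B v (lprod B u w).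
Proof.
apply: (mulfI n2); rewrite mulrN (symformC v) !lprodE //.
by rewrite (lieC w u) (lieC w v) (lieC v u) !symformE; ring.
Qed.

Lemma lprod_torsion_free u v : lprod B u v - lprod B v u = lie u v.
Proof.
apply: symform_inj => w; apply: (mulfI n2); rewrite !symformE mulrBr !lprodE //.
by rewrite (lieC v u) !symformE; ring.
Qed.

(** [lprod] is built from the inverse of [flat], so linearity is recovered by pairing with test
    vectors. The bundled copy gives access to the generic linearity lemmas. *)
Lemma lprod_bilinear :
  exists P : {bilinear g -> g -> g}, forall u v, lprod B u v = P u v.
Proof.
have bil : bilinear_for *:%R *:%R (lprod B).
  split=> [v k p q | u k p q]; apply: symform_inj => w; apply: (mulfI n2);
  rewrite !symformE mulrDr mulrCA !lprodE // !lieE !symformE; ring.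
pose P := HB.pack_for {bilinear g -> g -> g} (lprod B)
  (bilinear_isBilinear.Build _ _ _ _ _ _ _ bil).
by exists P.
Qed.

End Algebra.
Arguments symformC {F g B}.

(** * Existence of an abelian plane *)

Lemma abelian_plane_of_relation (F : fieldType) (g : lieAlgType F)
    (x y z : g) (a b c : F) : a != 0 ->
  free [:: x; y; z] -> a *: lie y z + b *: lie z x + c *: lie x y = 0 ->
  exists u v : g, free [:: u; v] /\ lie u v = 0.
Proof.
move=> a0 /free3P fr rel.
(* Bivectors in dimension 3 are decomposable: for nonzero a, the bivector a y/\z + b z/\x + c x/\y
   equals (a y - b x) /\ (z - (c/a) x). *)
exists (a *: y - b *: x), (z - (c / a) *: x); split.
  apply/free2P => k l E.
  have /fr[_ ka0 l0] :
      (- (k * b) - l * (c / a)) *: x + (k * a) *: y + l *: z = 0.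
    by rewrite -E; vector_ring.
  by move/eqP: ka0; rewrite mulf_eq0 (negPf a0) orbF => /eqP.
rewrite -rel !lieE (lieC y x) (lieC x z).
have -> : c *: lie x y = a *: ((c / a) *: lie x y).
  by rewrite scalerA mulrCA divff ?mulr1.
by vector_ring.
Qed.

Section Plane.
Variables (F : fieldType) (g : lieAlgType F) (P : {bilinear g -> g -> g}).
Hypotheses (n2 : 2%:R != 0 :> F).
Hypothesis torsion_free : forall u v, P u v - P v u = lie u v.
Hypothesis compat : forall u v w, lie (P u v) w + lie u (P w v) = 0.

(** If the brackets were free, [compat] on the three pairs of basis vectors would give nine scalar
    equations on the matrix of T_v: six kill the off-diagonal entries, and three make the diagonal
    entries sum to 0 in pairs, so they vanish because 2 is invertible. Then all products are 0, and
    so are all brackets. *)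
Lemma brackets_not_free (x y z : g) : basis_of {: g} [:: x; y; z] ->
  ~~ free [:: lie y z; lie z x; lie x y].
Proof.
move=> bas; apply/negP => /[dup] /free3P fr3 fr.
have T0 v u : P u v = 0.
  have [a1 [a2 [a3 Px]]] := basis3_span (P x v) bas.
  have [b1 [b2 [b3 Py]]] := basis3_span (P y v) bas.
  have [c1 [c2 [c3 Pz]]] := basis3_span (P z v) bas.
  have : (- a3) *: lie y z + (- b3) *: lie z x + (a1 + b2) *: lie x y = 0.
    rewrite -(compat x v y) Px Py !lieE (lieC z y) (lieC x z); vector_ring.
  have : (b2 + c3) *: lie y z + (- b1) *: lie z x + (- c1) *: lie x y = 0.
    rewrite -(compat y v z) Py Pz !lieE (lieC x z) (lieC y x); vector_ring.
  have : (- a2) *: lie y z + (c3 + a1) *: lie z x + (- c2) *: lie x y = 0.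
    rewrite -(compat z v x) Px Pz !lieE (lieC y x) (lieC z y); vector_ring.
  move=> /fr3[a20 ca c20] /fr3[bc b10 c10] /fr3[a30 b30 ab].
  have a1b : a1 = - b2 by apply/eqP; rewrite -addr_eq0 ab.
  have c3b : c3 = - b2 by apply/eqP; rewrite -addr_eq0 addrC bc.
  have b20 : b2 = 0.
    apply/(mulfI n2)/oppr_inj; rewrite mulr0 oppr0 -ca a1b c3b; ring.
  move/eqP: a30; rewrite oppr_eq0 => /eqP a30.
  move/eqP: b30; rewrite oppr_eq0 => /eqP b30.
  move/eqP: b10; rewrite oppr_eq0 => /eqP b10.
  move/eqP: c10; rewrite oppr_eq0 => /eqP c10.
  move/eqP: a20; rewrite oppr_eq0 => /eqP a20.
  move/eqP: c20; rewrite oppr_eq0 => /eqP c20.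
  have [k [l [m ->]]] := basis3_span u bas.
  rewrite !linearDl !linearZl_LR Px Py Pz a1b c3b b20 a20 a30 b10 b30 c10 c20.
  by vector_ring.
by have := free_not0 fr (mem_head _ _); rewrite -torsion_free !T0 subrr eqxx.
Qed.

Lemma abelian_plane : \dim {: g} = 3%N ->
  exists u v : g, free [:: u; v] /\ lie u v = 0.
Proof.
move=> d3; have [x [y [z bas]]] := dim3_basis d3.
have fr := basis_free bas.
have [//|nfr] := boolP (free [:: lie y z; lie z x; lie x y]).
  by rewrite (negPf (brackets_not_free bas)).
have [a [b [c [rel /or3P nz]]]] := nfree3P nfr.
(* A cyclic rotation of [x], [y], [z] brings the nonzero coefficient to the front. *)
case: nz => nz; first exact: abelian_plane_of_relation nz fr rel.
  apply: (abelian_plane_of_relation (y := z) (z := x) nz (b := c) (c := a)).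
    by rewrite (perm_free (Y := rot 2 [:: y; z; x])) // perm_sym perm_rot.
  by rewrite -rel; vector_ring.
apply: (abelian_plane_of_relation (y := x) (z := y) nz (b := a) (c := b)).
  by rewrite (perm_free (Y := rot 1 [:: z; x; y])) // perm_sym perm_rot.
by rewrite -rel; vector_ring.
Qed.
End Plane.

(** * Orthogonality, and the normal form for trivial center *)

Lemma dim3_orthogonal_vector (F : fieldType) (g : vectType F)
    (B : {symmetric g}) (y z : g) : \dim {: g} = 3%N -> exists s,
  [/\ s != 0, B s y = 0 & B s z = 0].
Proof.
move=> d3.
(* Each orthogonality condition lowers the dimension by at most one, so [V2] is nonzero. *)
pose V1 := ({: g} :&: orthov B <[y]>)%VS.
pose V2 := (V1 :&: orthov B <[z]>)%VS.
have := leq_dim_orthov1 B z V1; rewrite -/V2 => dV2.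
have := leq_dim_orthov1 B y {: g}; rewrite -/V1 d3 /= => dV1.
have : vpick V2 != 0.
  rewrite vpick0 -dimv_eq0 -lt0n; apply: leq_trans dV2.
  by case: (\dim V1) dV1 => [|[]].
move=> s0; exists (vpick V2); have := memv_pick V2.
rewrite memv_cap => /andP[]; rewrite memv_cap => /andP[_].
by rewrite !mem_orthov1 => /eqP -> /eqP ->.
Qed.

Section TrivialCenter.
Variables (F : fieldType) (g : lieAlgType F) (B : {symmetric g}).
Variable P : {bilinear g -> g -> g}.
Hypotheses (n2 : 2%:R != 0 :> F) (nd : nondegenerate B).
Hypothesis torsion_free : forall u v, P u v - P v u = lie u v.
Hypothesis skew : forall u v w, B (P u v) w = - B v (P u w).
Hypothesis compat : forall u v w, lie (P u v) w + lie u (P w v) = 0.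
Hypotheses (d3 : \dim {: g} = 3%N) (center0 : trivial_center g).
Implicit Types (u v w x y z e : g).

Lemma skew_diag u v : B (P u v) v = 0.
Proof.
apply: (mulfI n2); rewrite mulr0 mulr_natl mulr2n {1}skew symformC addNr //.
Qed.

(** From t(v) (e, v) = (ev, v) = 0, the product ev vanishes when (e, v) is nonzero. Non-degeneracy
    gives one such vector w; a vector v orthogonal to e is the difference of v + w and w, neither of
    which is orthogonal to e. *)
Lemma mul_eq0_of_scaling e (t : g -> F) :
  e != 0 -> (forall v, P e v = t v *: e) -> forall v, P e v = 0.
Proof.
move=> e0 tE.
have key v : B e v != 0 -> P e v = 0.
  move=> ev; have /eqP := skew_diag e v.
  by rewrite tE symformZl mulf_eq0 (negPf ev) orbF => /eqP->; rewrite scale0r.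
have /mem_orthovPn[w _ ew] : e \notin orthov B {: g} by rewrite (eqP nd) memv0.
move=> v; have [ev|/key//] := eqVneq (B e v) 0.
have := key (v + w).
by rewrite symformDr ev add0r linearDr (key w) // addr0; apply.
Qed.

Section AdaptedBasis.
Variables x y z : g.
Hypotheses (bas : basis_of {: g} [:: x; y; z]) (yz0 : lie y z = 0).

(** A vector of the abelian plane that commutes with [x] is central, hence zero. *)
Lemma plane_adjoint_free : free [:: lie x y; lie x z].
Proof.
have /free3P fr := basis_free bas.
apply/free2P => k l E.
suff kl0 : k *: y + l *: z = 0.
  by have /fr[_ -> ->] : 0 *: x + k *: y + l *: z = 0
    by rewrite scale0r add0r.
apply: center0 => v; have [a [b [c ->]]] := basis3_span v bas.
rewrite !lieE (lieC y x) (lieC z x) (lieC z y) yz0 oppr0.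
by transitivity (- a *: (k *: lie x y + l *: lie x z));
  [vector_ring | rewrite E scaler0].
Qed.

(** As [y,z] = 0 while [x,y] and [x,z] are independent, [compat] on the three pairs forces T_v to
    act on the plane as a scalar t, and on [x] as -t modulo the plane. Then [mul_eq0_of_scaling]
    gives t = 0. *)
Lemma mul_plane v : [/\ P y v = 0, P z v = 0 &
  exists b c, P x v = b *: y + c *: z].
Proof.
have /free2P fr := plane_adjoint_free.
have Tv w : exists t a b, [/\ P x w = - t *: x + a *: y + b *: z,
                              P y w = t *: y & P z w = t *: z].
  have [a1 [a2 [a3 Px]]] := basis3_span (P x w) bas.
  have [b1 [b2 [b3 Py]]] := basis3_span (P y w) bas.
  have [c1 [c2 [c3 Pz]]] := basis3_span (P z w) bas.
  have /fr[c10 b10] : (- c1) *: lie x y + b1 *: lie x z = 0.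
    rewrite -(compat y w z) Py Pz !lieE (lieC y x) yz0; vector_ring.
  have /fr[ab b30] : (a1 + b2) *: lie x y + b3 *: lie x z = 0.
    rewrite -(compat x w y) Px Py !lieE (lieC z y) yz0; vector_ring.
  have /fr[c20 ac] : c2 *: lie x y + (a1 + c3) *: lie x z = 0.
    rewrite -(compat x w z) Px Pz !lieE yz0; vector_ring.
  have b2a : b2 = - a1 by apply/eqP; rewrite -addr_eq0 addrC ab.
  have c3a : c3 = - a1 by apply/eqP; rewrite -addr_eq0 addrC ac.
  move/eqP: c10; rewrite oppr_eq0 => /eqP c10.
  exists (- a1), a2, a3; rewrite Px Py Pz b10 b30 c10 c20 b2a c3a.
  by split; vector_ring.
(* [Tv] yields a scalar for each w separately; the coordinate along [y] turns it into a function of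
   w. *)
pose t w := coord [tuple y] 0 (P y w).
have y0 : y != 0 by apply: basis_not0 bas _; rewrite !inE eqxx orbT.
have z0 : z != 0 by apply: basis_not0 bas _; rewrite !inE eqxx !orbT.
have tE w : P y w = t w *: y /\ P z w = t w *: z.
  have [s [a [b [_ Ey Ez]]]] := Tv w.
  suff -> : t w = s by [].
  rewrite /t Ey linearZ /= (coord_free 0 0 (X := [tuple y])) ?mulr1 //.
  by rewrite seq1_free.
have yv := mul_eq0_of_scaling y0 (fun w => (tE w).1) v.
have zv := mul_eq0_of_scaling z0 (fun w => (tE w).2) v.
split=> //; have [s [a [b [-> Ey _]]]] := Tv v.
exists a, b; move/eqP: Ey; rewrite yv eq_sym scaler_eq0 (negPf y0) orbF.
by move=> /eqP->; rewrite oppr0 scale0r add0r.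
Qed.

Lemma mul_in_plane u v : exists b c, P u v = b *: y + c *: z.
Proof.
have [a [b [c ->]]] := basis3_span u bas; rewrite !linearDl !linearZl_LR.
have [-> -> [b' [c' ->]]] := mul_plane v; exists (a * b'), (a * c').
by vector_ring.
Qed.

(** Polarization: if y and z are isotropic, then (y+z, y+z) = 2 (y, z), and (y, z) = 0 would make y
    orthogonal to the whole basis s, y, z. *)
Lemma plane_anisotropic s : B s y = 0 -> B s z = 0 ->
  basis_of {: g} [:: s; y; z] ->
  exists b c, B (b *: y + c *: z) (b *: y + c *: z) != 0.
Proof.
move=> sy sz sbas.
have [yy|?] := eqVneq (B y y) 0; last first.
  by exists 1, 0; rewrite scale1r scale0r addr0.
have [zz|?] := eqVneq (B z z) 0; last first.
  by exists 0, 1; rewrite scale1r scale0r add0r.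
exists 1, 1; rewrite !scale1r !symformE yy zz (symformC z y).
rewrite add0r addr0 -mulr2n.
have y0 : y != 0 by apply: basis_not0 sbas _; rewrite !inE eqxx orbT.
rewrite -mulr_natl mulf_neq0 //; apply: contraNneq y0 => yz.
by apply/eqP/(symform_inj3 nd sbas); rewrite symform0l // symformC.
Qed.

Lemma normal_basis_of_plane : exists a b c x y z,
  [/\ [/\ a != 0, b != 0 & c != 0], normal_basis c x y z,
      [/\ [/\ P x x = 0, P x y = lie x y & P x z = lie x z],
          [/\ P y x = 0, P y y = 0 & P y z = 0] &
          [/\ P z x = 0, P z y = 0 & P z z = 0]] &
      normal_form B a b c x y z].
Proof.
have [s [s0 sy sz]] := dim3_orthogonal_vector B y z d3.
have sP u v : B s (P u v) = 0.
  by have [b [c ->]] := mul_in_plane u v; rewrite !symformE sy sz !mulr0 addr0.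
(* (vs, w) = -(s, vw) = 0, since products lie in the plane. Hence left multiplication by [s] is ad
   s. *)
have Ps v : P v s = 0.
  by apply: (symform_inj nd) => w; rewrite skew sP symform0l oppr0.
have Psl v : P s v = lie s v by rewrite -torsion_free Ps subr0.
have sbas : basis_of {: g} [:: s; y; z].
  apply: basis3_free => //; apply/free3P => k l m E.
  have /free3P fr := basis_free bas.
  have [a [b [c sE]]] := basis3_span s bas.
  (* Were [s] in the plane, ad s would vanish like every left multiplication by a plane vector, and
     [s] would be central. *)
  have a0 : a != 0.
    apply: contraNneq s0 => a0; apply/eqP/center0 => v.
    rewrite -Psl sE a0 !linearDl !linearZl_LR scale0r.
    by have [-> -> _] := mul_plane v; rewrite !scaler0 !addr0.
  have [ka lb mc] : [/\ k * a = 0, k * b + l = 0 & k * c + m = 0].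
    by apply: fr; rewrite -E sE; vector_ring.
  have k0 : k = 0 by move/eqP: ka; rewrite mulf_eq0 (negPf a0) orbF => /eqP.
  by move: lb mc; rewrite k0 !mul0r !add0r.
have [p [q]] := plane_anisotropic sy sz sbas.
set y' := _ + _ => yy0.
have Py v : P y' v = 0.
  rewrite linearDl !linearZl_LR; have [-> -> _] := mul_plane v.
  by rewrite !scaler0 addr0.
have sy' : B s y' = 0 by rewrite !symformE sy sz !mulr0 addr0.
move: y' yy0 Py sy' => y' yy0 Py sy'.
pose z' := P s y'.
have Pz v : P z' v = 0.
  have [b [c]] := mul_in_plane s y'; rewrite -/z' => ->.
  rewrite linearDl !linearZl_LR; have [-> -> _] := mul_plane v.
  by rewrite !scaler0 addr0.
have z'y' : B z' y' = 0 by apply: skew_diag.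
have ss0 : B s s != 0.
  apply: contraNneq s0 => ss; apply/eqP/(symform_inj3 nd sbas);
  by rewrite symform0l.
have y'0 : y' != 0 by apply: contraNneq yy0 => ->; rewrite symform0l.
(* If sy' = 0, then y' commutes with [s] and with the plane, so it is central. *)
have z'0 : z' != 0.
  apply: contraNneq y'0 => z'0; apply/eqP/center0 => v.
  have [a [b [c ->]]] := basis3_span v sbas.
  rewrite !lieE (lieC y' s) -Psl -/z' z'0 -!torsion_free !Py.
  have [-> _ _] := mul_plane y'; have [_ -> _] := mul_plane y'.
  by rewrite !(oppr0, subr0, scaler0, addr0).
have nbas : basis_of {: g} [:: s; y'; z'].
  apply: basis3_free => //; apply/free3P => k l m E.
  have k0 : k = 0.
    have /eqP := congr1 (B s) E; rewrite !symformE sy' sP !mulr0 !addr0.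
    by rewrite mulf_eq0 (negPf ss0) orbF => /eqP.
  have l0 : l = 0.
    have /eqP := congr1 (B y') E.
    rewrite !symformE (symformC y' s) sy' (symformC y') z'y'.
    by rewrite !mulr0 add0r addr0 mulf_eq0 (negPf yy0) orbF => /eqP.
  move/eqP: E; rewrite k0 l0 !scale0r !add0r scaler_eq0 (negPf z'0) orbF.
  by move=> /eqP.
have zz0 : B z' z' != 0.
  apply: contraNneq z'0 => zz; apply/eqP/(symform_inj3 nd nbas);
  by rewrite symform0l // symformC sP.
(* sz' is orthogonal to [s], being a product, and to z', by skewness; only the direction of y'
   remains. *)
have [c szE] : exists c, P s z' = c *: y'.
  have [k [l [m E]]] := basis3_span (P s z') nbas.
  exists l; rewrite E.
  have k0 : k = 0.
    have /eqP := congr1 (B s) E; rewrite !symformE sy' !sP !mulr0 !addr0 eq_sym.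
    by rewrite mulf_eq0 (negPf ss0) orbF => /eqP.
  have m0 : m = 0.
    have /eqP := congr1 (B^~ z') E.
    rewrite skew_diag !symformE sP (symformC y') z'y'.
    by rewrite !mulr0 !add0r eq_sym mulf_eq0 (negPf zz0) orbF => /eqP.
  by rewrite k0 m0 !scale0r add0r addr0.
(* (sy', z') = -(y', sz'): this is the source of the value -bc, and c is nonzero because z' is
   anisotropic. *)
have zzE : B z' z' = - (B y' y' * c).
  by rewrite {1}/z' skew szE symformZr mulrC.
exists (B s s), (B y' y'), c, s, y', z'; split.
- split=> //; apply: contraNneq zz0 => c0; by rewrite zzE c0 mulr0 oppr0.
- by split; rewrite -?Psl // -torsion_free Py Pz subr0.
- by do !split=> //.
by split; split=> //; rewrite ?sP // symformC.
Qed.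

End AdaptedBasis.
End TrivialCenter.

Lemma pseudo_riemannian_normal_form (F : fieldType) (g : lieAlgType F)
    (B : {symmetric g}) :
  \dim {: g} = 3%N -> trivial_center g -> pseudo_riemannian_lie B ->
  exists (a b c : F) (x y z : g),
    [/\ [/\ a != 0, b != 0 & c != 0], normal_basis c x y z,
        normal_product B x y z & normal_form B a b c x y z].
Proof.
move=> d3 center0 [char2 nd compat].
have n2 : 2%:R != 0 :> F by move: char2; rewrite inE.
have [P PE] := lprod_bilinear char2 nd.
have tors u v : P u v - P v u = lie u v by rewrite -!PE lprod_torsion_free.
have skew u v w : B (P u v) w = - B v (P u w) by rewrite -!PE lprod_skew.
have {}compat u v w : lie (P u v) w + lie u (P w v) = 0 by rewrite -!PE compat.
have [y [z [fr yz0]]] := abelian_plane n2 tors compat d3.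
have [x bas] := basis3_complete d3 fr.
have := normal_basis_of_plane n2 nd tors skew compat d3 center0 bas yz0.
move=> [a [b [c [x' [y' [z' [abc nb np nf]]]]]]].
by exists a, b, c, x', y', z'; split=> //; rewrite /normal_product !PE.
Qed.

(** * From a normal basis back to a compatible form *)

Section NormalBasis.
Variables (F : fieldType) (g : lieAlgType F).
Variables (a b c : F) (x y z : g).
Hypotheses (n2 : 2%:R != 0 :> F) (nb : normal_basis c x y z).

Lemma normal_form_nondegenerate (B : {symmetric g}) :
  a != 0 -> b != 0 -> c != 0 -> normal_form B a b c x y z -> nondegenerate B.
Proof.
move=> a0 b0 c0 [[xx yy zz] [xy xz yz]]; have [bas _ _ _] := nb.
apply/nondegenerateP => u u0; have [k [l [m uE]]] := basis3_span u bas.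
move: (u0 x) (u0 y) (u0 z); rewrite {}uE !symformE xx yy zz xy xz yz.
rewrite (symformC y x) (symformC z x) (symformC z y) xy xz yz.
rewrite !mulr0 !addr0 !add0r mulrN => /eqP kE /eqP lE /eqP mE.
move: kE lE mE; rewrite oppr_eq0 !mulf_eq0.
rewrite (negPf a0) (negPf b0) (negPf c0) !orbF.
by move=> /eqP-> /eqP-> /eqP->; rewrite !scale0r !addr0.
Qed.

Lemma normal_form_product (B : {symmetric g}) :
  nondegenerate B -> normal_form B a b c x y z -> normal_product B x y z.
Proof.
move=> nd [[xx yy zz] [xy xz yz]]; have [bas lxy lxz lyz] := nb.
have char2 : 2%N \notin [pchar F] by rewrite inE n2.
have [yx zx zy] : [/\ B y x = 0, B z x = 0 & B z y = 0].
  by rewrite !(symformC _ x) (symformC z) xy xz yz.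
have lyx : lie y x = - z by rewrite lieC lxy.
have lzx : lie z x = - (c *: y) by rewrite lieC lxz.
have lzy : lie z y = 0 by rewrite lieC lyz oppr0.
rewrite /normal_product lxy lxz.
by do !split; apply: (symform_inj3 nd bas); apply: (mulfI n2);
  rewrite lprodE // ?(lxy, lxz, lyz, lyx, lzx, lzy) ?lieE ?symformE
    ?(xx, yy, zz, xy, xz, yz, yx, zx, zy); ring.
Qed.

(** Left multiplication by u is u1 ad x, where u1 is the [x]-coordinate. As X = [x,v] lies in the
    abelian plane of [y] and [z], [uv,w] + [u,wv] = u1 [X,w] + w1 [u,X] = -u1 w1 [x,X] + w1 u1 [x,X]
    = 0. *)
Lemma normal_product_compatible (B : {symmetric g}) :
  nondegenerate B -> normal_product B x y z -> pseudo_riemannian_lie B.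
Proof.
move=> nd [[xx xy xz] [yx yy yz] [zx zy zz]]; have [bas lxy lxz lyz] := nb.
have char2 : 2%N \notin [pchar F] by rewrite inE n2.
split=> // u v w; have [P PE] := lprod_bilinear char2 nd.
move: xx xy xz yx yy yz zx zy zz; rewrite !PE => xx xy xz yx yy yz zx zy zz.
have PxE v' : P x v' = lie x v' /\ P y v' = 0 /\ P z v' = 0.
  have [v1 [v2 [v3 ->]]] := basis3_span v' bas.
  rewrite !linearDr !linearZr_LR xx xy xz yx yy yz zx zy zz.
  by rewrite liexx !(scaler0, addr0).
have PE1 k l m v' : P (k *: x + l *: y + m *: z) v' = k *: lie x v'.
  have [Px [Py Pz]] := PxE v'.
  by rewrite !linearDl !linearZl_LR Px Py Pz !scaler0 !addr0.
have [p [q xvE]] : exists p q, lie x v = p *: y + q *: z.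
  have [v1 [v2 [v3 ->]]] := basis3_span v bas; exists (v3 * c), v2.
  rewrite !linearDr !linearZr_LR liexx scaler0 add0r lxy lxz scalerA.
  exact: addrC.
have plane k l m : lie (k *: x + l *: y + m *: z) (lie x v) =
    k *: lie x (lie x v).
  rewrite xvE !linearDl !linearZl_LR [lie y _]linearDr [lie z _]linearDr.
  rewrite !linearZr_LR !liexx (lieC z y) lyz.
  by rewrite !(oppr0, scaler0, addr0).
have [u1 [u2 [u3 uE]]] := basis3_span u bas.
have [w1 [w2 [w3 wE]]] := basis3_span w bas.
rewrite uE wE !PE1 lieZl lieZr (lieC (lie x v)) !plane.
by rewrite scalerN !scalerA mulrC addNr.
Qed.

Lemma normal_form_exists : exists B : {symmetric g}, normal_form B a b c x y z.
Proof.
have [bas _ _ _] := nb; have fr := basis_free bas.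
pose X := [tuple x; y; z]; pose k i := coord X i.
pose f (u v : g) := a * k 0 u * k 0 v + b * k 1 u * k 1 v
  - b * c * k (lift ord0 (lift ord0 ord0)) u * k (lift ord0 (lift ord0 ord0)) v.
have bil : bilinear_for *%R (idfun \; *%R) f.
  by split=> [v l p q|u l p q]; rewrite /f /k !linearP /=; ring.
(* Symmetry is the hermitian condition with sign [(-1) ^+ false] and twist [idfun]. *)
have her p q : f p q = (-1) ^+ false * idfun (f q p).
  by rewrite /f /=; ring.
pose P := HB.pack_for {symmetric g} f
  (bilinear_isBilinear.Build _ _ _ _ _ _ _ bil)
  (isHermitianSesquilinear.Build _ _ _ _ _ her).
have kE i (j : 'I_3) : k i X`_j = (i == j)%:R.
  by rewrite eq_sym; apply: coord_free.
exists P.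
have /= kx i := kE i 0; have /= ky i := kE i 1.
have /= kz i := kE i (lift ord0 (lift ord0 ord0)).
by do !split; rewrite /= /f ?kx ?ky ?kz /=; ring.
Qed.

End NormalBasis.

(** * The positive definite case *)

Section Riemannian.
Variables (R : realType) (g : lieAlgType R) (B : {symmetric g}).
Hypothesis d3 : \dim {: g} = 3%N.

Lemma riemann_trivial_center :
  riemann_lie B -> ~ abelian_lie g -> trivial_center g.
Proof.
move=> [[char2 nd compat] pos] nab r rc; apply/eqP/contraT => r0; case: nab.
have n2 : 2%:R != 0 :> R by move: char2; rewrite inE.
have [P PE] := lprod_bilinear char2 nd.
have tors u v : P u v - P v u = lie u v by rewrite -!PE lprod_torsion_free.
have skew u v w : B (P u v) w = - B v (P u w) by rewrite -!PE lprod_skew.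
have {}compat u v w : lie (P u v) w + lie u (P w v) = 0 by rewrite -!PE compat.
have def0 u : B u u = 0 -> u = 0.
  by move=> u0; apply/eqP; apply: contraT => /pos; rewrite u0 ltxx.
have comm s (sc : forall v, lie s v = 0) v : P s v = P v s.
  by apply/eqP; rewrite -subr_eq0 tors sc.
(* In [compat] the term [r, wv] vanishes, so rv is central as well. *)
have Prc v w : lie (P r v) w = 0.
  by rewrite -[LHS]addr0 -[X in _ + X](rc (P w v)) compat.
(* Central vectors also commute for the product, so (rs,w) = (sr,w) = -(r,sw) = -(r,ws) = (wr,s) =
   (rw,s) = -(w,rs). *)
have Pr2 v : P r (P r v) = 0.
  set s := P r v; have sc := Prc v : forall w, lie s w = 0.
  apply: (symform_inj nd) => w; apply: (mulfI n2).
  rewrite symform0l mulr0 mulr_natl mulr2n {1}comm // skew (comm s sc) -skew.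
  by rewrite -(comm r rc) skew (symformC w) addNr.
have Pr v : P r v = 0 by apply: def0; rewrite skew Pr2 symform0r oppr0.
have Br u v : B r (P u v) = 0.
  by rewrite symformC skew -(comm r rc) Pr symform0r oppr0.
(* Extend [r] to an orthogonal basis r, f, h. *)
have [f [f0 fr _]] := dim3_orthogonal_vector B r r d3.
have [h [h0 hr hf]] := dim3_orthogonal_vector B r f d3.
have nz u : u != 0 -> B u u != 0 by apply: contraNneq => /def0->.
have coef k l m u v w : B u v = 0 -> B u w = 0 -> u != 0 ->
    B u (k *: u + l *: v + m *: w) = 0 -> k = 0.
  move=> uv uw /nz uu; rewrite !symformE uv uw !mulr0 !addr0 => /eqP.
  by rewrite mulf_eq0 (negPf uu) orbF => /eqP.
have [rf rh fh] : [/\ B r f = 0, B r h = 0 & B f h = 0].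
  by rewrite !(symformC _ h) (symformC r) fr hr hf.
have fE k l m : B f (k *: r + l *: f + m *: h) = 0 -> l = 0.
  by rewrite [k *: r + _]addrC; apply: coef.
have hE k l m : B h (k *: r + l *: f + m *: h) = 0 -> m = 0.
  by rewrite addrC [k *: r + _]addrC addrA; apply: coef.
have bas : basis_of {: g} [:: r; f; h].
  apply: basis3_free => //; apply/free3P => k l m E.
  by split; [apply: (coef k l m r f h) | apply: (fE k l m) | apply: (hE k l m)];
    rewrite ?E ?symform0r.
have diag u v : B v (P u v) = 0.
  apply: (mulfI n2); rewrite mulr0 mulr_natl mulr2n -[in X in X + _]symformC.
  by rewrite skew addNr.
(* Products are orthogonal to [r], and uf is orthogonal to f by skewness, so it is a multiple of
   h. *)
have Pf u : exists m, P u f = m *: h.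
  have [k [l [m E]]] := basis3_span (P u f) bas.
  have k0 : k = 0 by apply: (coef k l m r f h); rewrite -?E.
  have l0 : l = 0 by apply: (fE k l m); rewrite -E diag.
  by exists m; rewrite E k0 l0 !scale0r !add0r.
have Ph u : exists l, P u h = l *: f.
  have [k [l [m E]]] := basis3_span (P u h) bas.
  have k0 : k = 0 by apply: (coef k l m r f h); rewrite -?E.
  have m0 : m = 0 by apply: (hE k l m); rewrite -E diag.
  by exists l; rewrite E k0 m0 !scale0r add0r addr0.
(* With fh = l f and hf = m h, [compat] gives l [f,h] = m [f,h] = 0; and if l = m = 0, then [f,h] =
   fh - hf = 0. *)
have lfh : lie f h = 0.
  have [k Pff] := Pf f; have [l Pfh] := Ph f.
  have [m Phf] := Pf h; have [n Phh] := Ph h.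
  have := compat f f h; have := compat f h h.
  rewrite Pff Pfh Phf Phh !lieE !scaler0 addr0 add0r => /eqP + /eqP.
  rewrite !scaler_eq0 => /orP[/eqP l0|/eqP//] /orP[/eqP m0|/eqP//].
  by rewrite -tors Pfh Phf l0 m0 !scale0r subrr.
move=> u v; have [u1 [u2 [u3 ->]]] := basis3_span u bas.
have [v1 [v2 [v3 ->]]] := basis3_span v bas.
rewrite !lieE !rc (lieC f r) (lieC h r) (lieC h f) lfh !rc.
by rewrite !(oppr0, scaler0, addr0).
Qed.

Lemma riemann_orthonormal_basis :
  riemann_lie B -> ~ abelian_lie g ->
   \dim (derived g) = 2%N /\
     exists (s x y : g) (alpha : R),
       [/\ basis_of {: g} [:: s; x; y] /\ orthonormal B [:: s; x; y],
           in_Zr B s,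
           x \in derived g /\ y \in derived g,
           lie s x = lprod B s x /\ lprod B s x = alpha *: y &
           lie s y = lprod B s y /\ lprod B s y = - alpha *: x].
Proof.
move=> riem nab; have center0 := riemann_trivial_center riem nab.
have [pr pos] := riem; have [char2 nd _] := pr.
have [a [b [c [x [y [z [[a0 b0 c0] nb np nf]]]]]]] :=
  pseudo_riemannian_normal_form d3 center0 pr.
have [bas lxy lxz lyz] := nb.
have [[xx xy xz] [yx yy yz] [zx zy zz]] := np.
have [[Bxx Byy Bzz] [Bxy Bxz Byz]] := nf.
have zd : z \in derived g by rewrite -lxy; apply: (derivedP _).2.
have yd : y \in derived g.
  rewrite -[y](scalerK c0) -lxz; apply: rpredZ; exact: (derivedP _).2.
have frs := basis_free bas.
have dder : derived g = <<[:: y; z]>>%VS.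
  apply/eqP; rewrite eqEsubv; apply/andP; split; last first.
    by apply/span_subvP => u; rewrite !inE => /orP[] /eqP->.
  have ym : y \in <<[:: y; z]>>%VS by apply: memv_span; rewrite inE eqxx.
  have zm : z \in <<[:: y; z]>>%VS by apply: memv_span; rewrite !inE eqxx orbT.
  apply/derivedP => u v.
  have [u1 [u2 [u3 ->]]] := basis3_span u bas.
  have [v1 [v2 [v3 ->]]] := basis3_span v bas.
  rewrite !lieE (lieC y x) (lieC z x) (lieC z y) lxy lxz lyz.
  by rewrite !(rpredD, rpredZ, rpredN, mem0v, scaler0, oppr0).
split.
  (* [free] unfolds to the equality of the dimension of the span with the length. *)
  apply/eqP; rewrite dder; change (free [:: y; z]).
  by move: frs; rewrite free_cons => /andP[].
have pa : 0 < a by rewrite -Bxx pos // (basis_not0 bas) ?inE ?eqxx.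
have pb : 0 < b by rewrite -Byy pos // (basis_not0 bas) ?inE ?eqxx ?orbT.
have pc : 0 < - (b * c).
  by rewrite -Bzz pos // (basis_not0 bas) ?inE ?eqxx ?orbT.
set p := Num.sqrt a; set q := Num.sqrt b; set r := Num.sqrt (- (b * c)).
have [p0 q0 r0] : [/\ p != 0, q != 0 & r != 0].
  by rewrite !gt_eqF ?sqrtr_gt0.
have [p2 q2 r2] : [/\ p ^+ 2 = a, q ^+ 2 = b & r ^+ 2 = - (b * c)].
  by rewrite !sqr_sqrtr ?ltW.
have [P PE] := lprod_bilinear char2 nd.
rewrite /in_Zr; move: xx xy xz yx yy yz zx zy zz; rewrite !PE.
move=> xx xy xz yx yy yz zx zy zz.
(* [p], [q], [r] are the lengths of x, y, z. Since [x/p, y/q] = z/(pq), the rotation speed alpha is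
   r/(pq). *)
exists (p^-1 *: x), (q^-1 *: y), (r^-1 *: z), (r / (p * q)).
have E1 : lie (p^-1 *: x) (q^-1 *: y) = (r / (p * q)) *: (r^-1 *: z).
  rewrite !lieE lxy !scalerA; congr (_ *: _); field; exact/and3P.
have E2 : lie (p^-1 *: x) (r^-1 *: z) = - (r / (p * q)) *: (q^-1 *: y).
  rewrite !lieE lxz !scalerA; congr (_ *: _).
  have -> : c = - r ^+ 2 / q ^+ 2 by rewrite r2 q2 opprK mulrC mulKf.
  by field; exact/and3P.
split.
- split.
    apply: basis3_free => //; apply/free3P => k l m; rewrite !scalerA.
    move=> /((free3P _ _ _).1 frs) [] /eqP + /eqP + /eqP.
    rewrite !mulf_eq0 !invr_eq0 (negPf p0) (negPf q0) (negPf r0) !orbF.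
    by move=> /eqP-> /eqP-> /eqP->.
  rewrite /orthonormal /= !symformE Bxx Byy Bzz Bxy Bxz Byz !mulr0 eqxx !andbT.
  by rewrite -{}r2 -{}p2 -{}q2; apply/and3P; split; apply/eqP; field.
- move=> v; have [v1 [v2 [v3 ->]]] := basis3_span v bas.
  rewrite PE !linearDl !linearZl_LR !linearZr_LR xx yx zx.
  by rewrite !(scaler0, addr0).
- by rewrite !rpredZ.
- by rewrite PE -E1 !lieE linearZl_LR linearZr_LR xy.
- by rewrite PE -E2 !lieE linearZl_LR linearZr_LR xz.
Qed.

Lemma normal_form_riemann (a b c : R) (x y z : g) :
  c < 0 -> normal_basis c x y z -> 0 < a -> 0 < b ->
  normal_form B a b c x y z -> riemann_lie B.
Proof.
move=> c0 nb a0 b0 nf.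
have n2 : 2%:R != 0 :> R by rewrite pnatr_eq0.
have bc0 : 0 < - (b * c) by rewrite oppr_gt0 pmulr_rlt0.
have nd : nondegenerate B.
  by apply: normal_form_nondegenerate nf;
    rewrite ?(gt_eqF a0, gt_eqF b0, lt_eqF c0).
have np := normal_form_product n2 nb nd nf.
split; first exact/(normal_product_compatible n2 nb nd np).
have [bas _ _ _] := nb; have [[xx yy zz] [xy xz yz]] := nf.
move=> u; have [k [l [m ->]]] := basis3_span u bas => u0.
rewrite !symformE (symformC y x) (symformC z x) (symformC z y).
rewrite xx yy zz xy xz yz.
(* As c < 0, this is a sum of squares with positive weights. *)
rewrite [X in 0 < X]
  (_ : _ = k ^+ 2 * a + l ^+ 2 * b + m ^+ 2 * - (b * c)); last by ring.
have pk := mulr_ge0 (sqr_ge0 k) (ltW a0).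
have pl := mulr_ge0 (sqr_ge0 l) (ltW b0).
have pm := mulr_ge0 (sqr_ge0 m) (ltW bc0).
rewrite lt0r !addr_ge0 // andbT; apply: contraNneq u0.
move=> /eqP; rewrite !paddr_eq0 ?addr_ge0 // -andbA !mulf_eq0 !orbb.
rewrite (gt_eqF a0) (gt_eqF b0) (gt_eqF bc0) !orbF.
by move=> /and3P[/eqP-> /eqP-> /eqP->]; rewrite !scale0r !addr0.
Qed.

End Riemannian.

(** * The classification and its Riemannian consequences *)

Theorem proposition5p4 :
  (forall (F : fieldType) (g : lieAlgType F),
     [pchar F] =i pred0 -> \dim {: g} = 3%N -> trivial_center g ->
     [/\ (exists B : {symmetric g}, pseudo_riemannian_lie B) <->
           (exists (c : F) (x y z : g), c != 0 /\ normal_basis c x y z),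
         (forall B : {symmetric g}, nondegenerate B ->
            pseudo_riemannian_lie B <->
            exists (a b c : F) (x y z : g),
              [/\ [/\ a != 0, b != 0 & c != 0],
                  normal_basis c x y z,
                  normal_product B x y z &
                  normal_form B a b c x y z]) &
         (forall (c : F) (x y z : g), c != 0 -> normal_basis c x y z ->
          forall a b : F, a != 0 -> b != 0 ->
            exists B : {symmetric g},
              [/\ normal_form B a b c x y z,
                  pseudo_riemannian_lie B &
                  normal_product B x y z])])
  /\
  (forall (R : realType) (g : lieAlgType R),
     \dim {: g} = 3%N -> trivial_center g ->
     forall (c : R) (x y z : g), c < 0 -> normal_basis c x y z ->
     forall a b : R, 0 < a -> 0 < b ->
       exists B : {symmetric g}, normal_form B a b c x y z /\ riemann_lie B)
  /\
  (forall (R : realType) (g : lieAlgType R) (B : {symmetric g}),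
     \dim {: g} = 3%N -> ~ abelian_lie g -> riemann_lie B ->
     \dim (derived g) = 2%N /\
     exists (s x y : g) (alpha : R),
       [/\ basis_of {: g} [:: s; x; y] /\ orthonormal B [:: s; x; y],
           in_Zr B s,
           x \in derived g /\ y \in derived g,
           lie s x = lprod B s x /\ lprod B s x = alpha *: y &
           lie s y = lprod B s y /\ lprod B s y = - alpha *: x]).
Proof.
split=> [F g char0 d3 center0 | ].
  have n2 : 2%:R != 0 :> F by apply/negbT; have := char0 2%N; rewrite inE.
  have realize (c : F) (x y z : g) : c != 0 -> normal_basis c x y z ->
      forall a b : F, a != 0 -> b != 0 -> exists B : {symmetric g},
        [/\ normal_form B a b c x y z, pseudo_riemannian_lie B &
            normal_product B x y z].
    move=> c0 nb a b a0 b0; have [B nf] := normal_form_exists a b nb.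
    have nd := normal_form_nondegenerate nb a0 b0 c0 nf.
    have np := normal_form_product n2 nb nd nf.
    have pr := normal_product_compatible n2 nb nd np.
    by exists B.
  split=> //.
    split=> [[B pr]|[c [x [y [z [c0 nb]]]]]].
      have [a [b [c [x [y [z [[_ _ c0] nb _ _]]]]]]] :=
        pseudo_riemannian_normal_form d3 center0 pr.
      by exists c, x, y, z.
    have [B [_ pr _]] := realize c x y z c0 nb 1 1 (oner_neq0 _) (oner_neq0 _).
    by exists B.
  move=> B nd; split; first exact: pseudo_riemannian_normal_form.
  move=> [a [b [c [x [y [z [_ nb np _]]]]]]].
  exact/(normal_product_compatible n2 nb nd np).
split=> [R g _ _ c x y z c0 nb a b a0 b0 | R g B d3 nab riem].
  have [B nf] := normal_form_exists a b nb.
  by exists B; split=> //; apply: normal_form_riemann nf.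
exact: riemann_orthonormal_basis.
Qed.
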